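(* Let $C>0$ be a constant and let $(p_N)_{N\in\mathbb{N}}$ be a sequence of monic univariate polynomials with complex coefficients, $p_N$ of degree $N$, such that $\mu_{\rm norm}(p_N)\le C\sqrt{N}$ for all $N$. For each $N$ let $\omega_N=\{x_1,\dots,x_N\}\subset\mathbb{S}^2$ be the set of points with $\pi_{\mathbb{S}^2}(x_i)=z_i$, where $z_1,\dots,z_N$ are the roots of $p_N$. Then there is a constant $c$ depending only on $C$ such that for all $N$, $$\mathcal{E}_{\log}(\omega_N)\le \min_{\mu_N\subset\mathbb{S}^2}\mathcal{E}_{\log}(\mu_N)+cN,$$ where the minimum runs over all $N$-point subsets $\mu_N$ of $\mathbb{S}^2$.
   Context: $\mathbb{S}^2\subset\mathbb{R}^3$ is the unit sphere. $\pi_{\mathbb{S}^2}:\mathbb{S}^2\setminus\{(0,0,1)\}\to\mathbb{C}$ is the stereographic projection $(a,b,c)\mapsto \frac{a+ib}{1-c}$. For $\omega_N=\{x_1,\dots,x_N\}\subset\mathbb{S}^2$, $\mathcal{E}_{\log}(\omega_N)=-\sum_{i\neq j}\log\|x_i-x_j\|$. The Bombieri–Weyl norm of $P(z)=\sum_{i=0}^N a_iz^i$ (degree $N$) is $\|P\|=\big(\sum_{i=0}^N\binom{N}{i}^{-1}|a_i|^2\big)^{1/2}$. For a root $z$ of $P$, $\mu_{\rm norm}(P,z)=N^{1/2}\frac{\|P\|(1+|z|^2)^{N/2-1}}{|P'(z)|}$ (equal to $\infty$ if $z$ is a multiple root), and $\mu_{\rm norm}(P)=\max_{z:P(z)=0}\mu_{\rm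 norm}(P,z)$. *)

(* Defs.v *)
From Stdlib Require Export Reals Lra List.
Open Scope R_scope.

Definition Cx : Type := (R * R)%type.
Definition Cre (z : Cx) : R := fst z.
Definition Cim (z : Cx) : R := snd z.
Definition C0 : Cx := (0, 0).
Definition C1 : Cx := (1, 0).
Definition Cadd (z w : Cx) : Cx := (Cre z + Cre w, Cim z + Cim w).
Definition Cmul (z w : Cx) : Cx :=
  (Cre z * Cre w - Cim z * Cim w, Cre z * Cim w + Cim z * Cre w).
Definition Cscal (r : R) (z : Cx) : Cx := (r * Cre z, r * Cim z).
Fixpoint Cpow (z : Cx) (n : nat) : Cx :=
  match n with O => C1 | S k => Cmul z (Cpow z k) end.
Definition Cnorm2 (z : Cx) : R := Cre z ^ 2 + Cim z ^ 2.
Definition Cabs (z : Cx) : R := sqrt (Cnorm2 z).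

Fixpoint fsum (n : nat) (f : nat -> R) : R :=
  match n with O => 0 | S k => fsum k f + f k end.
Fixpoint Cfsum (n : nat) (f : nat -> Cx) : Cx :=
  match n with O => C0 | S k => Cadd (Cfsum k f) (f k) end.

(* ---------- polynomials of degree N ----------
   A polynomial of degree (at most) N is given by N and its coefficient
   function a : nat -> Cx, P(z) = sum_{i=0}^N a i z^i (coefficients a i
   with i > N are ignored). *)
Definition peval (N : nat) (a : nat -> Cx) (z : Cx) : Cx :=
  Cfsum (S N) (fun i => Cmul (a i) (Cpow z i)).
Definition pderiv_eval (N : nat) (a : nat -> Cx) (z : Cx) : Cx :=
  Cfsum (S N) (fun i => Cscal (INR i) (Cmul (a i) (Cpow z (pred i)))).
Definition is_monic_deg (N : nat) (a : nat -> Cx) : Prop := a N = C1.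
Definition is_root (N : nat) (a : nat -> Cx) (z : Cx) : Prop :=
  peval N a z = C0.

Definition BW_norm (N : nat) (a : nat -> Cx) : R :=
  sqrt (fsum (S N) (fun i => Cnorm2 (a i) / Binomial.C N i)).

(* mu_norm(P,z) <= M, with the convention mu_norm(P,z) = +infinity at a
   multiple root (P'(z) = 0). *)
Definition mu_norm_at_le (N : nat) (a : nat -> Cx) (z : Cx) (M : R) : Prop :=
  pderiv_eval N a z <> C0 /\
  sqrt (INR N) * BW_norm N a * Rpower (1 + Cnorm2 z) (INR N / 2 - 1)
    / Cabs (pderiv_eval N a z) <= M.
Definition mu_norm_le (N : nat) (a : nat -> Cx) (M : R) : Prop :=
  forall z, is_root N a z -> mu_norm_at_le N a z M.

Definition P3 : Type := (R * R * R)%type.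
Definition px (x : P3) : R := fst (fst x).
Definition py (x : P3) : R := snd (fst x).
Definition pz (x : P3) : R := snd x.
Definition on_sphere (x : P3) : Prop := px x ^ 2 + py x ^ 2 + pz x ^ 2 = 1.
Definition north_pole : P3 := (0, 0, 1).
Definition dist3 (x y : P3) : R :=
  sqrt ((px x - px y) ^ 2 + (py x - py y) ^ 2 + (pz x - pz y) ^ 2).

Definition stereo (x : P3) : Cx := (px x / (1 - pz x), py x / (1 - pz x)).

Definition default_pt : P3 := (0, 0, 0).
Definition E_log (xs : list P3) : R :=
  - fsum (length xs) (fun i => fsum (length xs) (fun j =>
      if Nat.eq_dec i j then 0
      else ln (dist3 (nth i xs default_pt) (nth j xs default_pt)))).

Definition sphere_config (N : nat) (xs : list P3) : Prop :=
  length xs = N /\ NoDup xs /\ Forall on_sphere xs.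

(* Main.v *)
(** Write Z_j = |z_j|^2.  The condition number bound at the root z_i reads
    |P'(z_i)| >= ||P|| (1 + Z_i)^(N/2-1) / K, which bounds prod_(j <> i) |x_i - x_j| from
    below in terms of ||P|| / prod_j (1 + Z_j)^(1/2).  The latter is estimated through
    ||P||^2 = (N+1) int_0^1 sum_k |a_k|^2 t^k (1-t)^(N-k) dt: by Landau's inequality the
    integrand is at least prod_j max(t, Z_j (1-t)), and the mean of the logarithm of
    max(t, Z (1-t)) / (1+Z) over [0,1] is -1 for every Z, so that
    ||P||^2 >= (N+1)/2 e^(-N) prod_j (1 + Z_j).

    Conversely, representing the points of an arbitrary configuration by unit spinors
    (u_i, v_i), one has |y_i - y_j| = 2 |u_i v_j - u_j v_i|, and Hadamard's inequality for
    the matrix with entries C(N-1,k)^(1/2) u_i^k v_i^(N-1-k), whose rows are unit vectors,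
    gives prod_(i<j) |y_i - y_j|^2 <= 2^(N(N-1)) / prod_k C(N-1,k).  By Stirling's formula
    the two bounds on the energy agree up to O(N). *)

Require Import Defs.
From Stdlib Require Import Reals List Lia Lra Factorial.
From Coquelicot Require Import Coquelicot.
From mathcomp Require all_boot all_order all_algebra ring complex Rstruct.
Open Scope R_scope.

Definition Csub (z w : Cx) : Cx := (Cre z - Cre w, Cim z - Cim w).

Module Import Algebraic.
Import all_boot all_order all_algebra ring complex Rstruct.
Import Order.TTheory GRing.Theory Num.Theory.
Set Implicit Arguments. Unset Strict Implicit. Unset Printing Implicit Defensive.
Local Open Scope ring_scope.
Local Open Scope sesquilinear_scope.

(** * Weighted coefficient norms and Landau's inequality *)

Section RadialNorm.
Variable C : numClosedFieldType.
Implicit Types (p q : {poly C}) (a r : C).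

(** By Parseval, the mean of [|p| ^ 2] over the circle of squared radius [r]. *)
Definition wnorm r p := \sum_(i < size p) `|p`_i| ^+ 2 * r ^+ i.

Lemma wnorm_widen r p n : (size p <= n)%N ->
  wnorm r p = \sum_(i < n) `|p`_i| ^+ 2 * r ^+ i.
Proof.
move=> le_pn; rewrite /wnorm (big_ord_widen n (fun i => `|p`_i| ^+ 2 * r ^+ i) le_pn).
rewrite big_mkcond /=; apply: eq_bigr => i _; case: ltnP => // le_pi.
by rewrite nth_default // normr0 expr0n mul0r.
Qed.

Lemma wnorm_ge_coef r p n : 0 < r -> `|p`_n| ^+ 2 * r ^+ n <= wnorm r p.
Proof.
move=> r0; rewrite (@wnorm_widen r p (maxn (size p) n.+1)) ?leq_maxl //.
have lt_n : (n < maxn (size p) n.+1)%N by rewrite leq_max ltnSn orbT.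
rewrite (bigD1 (Ordinal lt_n)) //= lerDl sumr_ge0 // => i _.
by rewrite mulr_ge0 ?exprn_ge0 // ltW.
Qed.

(* On the circle [|z| ^ 2 = r] the factors [r^(1/2) (z - a)] and [a^* z - r] have the
   same modulus. *)
Lemma wnorm_reflect r a p : 0 < r ->
  r * wnorm r (('X - a%:P) * p) = wnorm r ((a^* *: 'X - r%:P) * p).
Proof.
move=> r0; pose n := size p.
have rc : r^* = r by rewrite geC0_conj // ltW.
have size2 x y : (size ((x *: 'X - y%:P) * p)%R <= n.+1)%N.
  apply: leq_trans (size_polyMleq _ _) _; rewrite -subn1 leq_subLR -/n.
  rewrite (leq_add2r n _ 2) (leq_trans (size_polyD _ _)) // geq_max size_polyN.
  rewrite (leq_trans (size_scale_leq _ _)) ?size_polyX //.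
  by rewrite (leq_trans (size_polyC_leq1 _)).
have coefs x y i : ((x *: 'X - y%:P) * p)`_i
   = (if i is j.+1 then x * p`_j else 0) - y * p`_i.
  rewrite mulrBl coefB coefCM -scalerAl coefZ coefXM.
  by case: i => [|i] //=; rewrite mulr0.
rewrite -{1}['X]scale1r (wnorm_widen r (size2 _ _)) (wnorm_widen r (size2 _ _)).
under eq_bigr do rewrite coefs; under [in RHS]eq_bigr do rewrite coefs.
have shift : `|p`_0| ^+ 2 + \sum_(i < n) `|p`_i.+1| ^+ 2 * r ^+ i.+1
    = \sum_(i < n) `|p`_i| ^+ 2 * r ^+ i.
  rewrite -/(wnorm r p) (wnorm_widen r (leqnSn n)) big_ord_recl /=.
  by rewrite expr0 mulr1.
rewrite !big_ord_recl /= !expr0 !mulr1 !sub0r !normrN.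
apply/eqP; rewrite -subr_eq0 mulrDr mulr_sumr opprD addrACA -sumrB.
(* The cross terms cancel index by index; the rest telescopes to the constant coefficient and
   cancels the two terms of index 0. *)
rewrite (eq_bigr (fun i : 'I_n => (r - a * a^*) * r * (`|p`_i| ^+ 2 * r ^+ i)
    - (r - a * a^*) * r * (`|p`_i.+1| ^+ 2 * r ^+ i.+1))); last first.
  by move=> i _; rewrite !normCK !rmorphB !rmorphM /= rc conjCK !exprS rmorph1; ring.
rewrite sumrB -!mulr_sumr -shift !normCK !rmorphM /= rc; apply/eqP; ring.
Qed.

(* Landau's inequality: the roots selected by [big], an arbitrary predicate, are
   reflected across the circle before reading off the leading coefficient. *)
Lemma wnorm_prod_XsubC (r : C) (big : pred C) (zs : seq C) (q : {poly C}) (m : nat) :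
  0 < r ->  (size q <= m.+1)%N ->
  `|q`_m| ^+ 2 * r ^+ m * \prod_(z <- zs) (if big z then `|z| ^+ 2 else r)
    <= wnorm r (q * \prod_(z <- zs) ('X - z%:P)).
Proof.
(* Each factor is absorbed into [q] and raises its formal degree [m]: a plain one gains a power of
   [r], while a reflected one multiplies the top coefficient by [z^*] and its gained [r] cancels the
   one of [wnorm_reflect]. *)
move=> r0; elim: zs q m => [|z zs IH] q m sz.
  by rewrite !big_nil !mulr1 wnorm_ge_coef.
have step x y : (size ((x *: 'X - y%:P) * q)%R <= m.+2)%N /\
    ((x *: 'X - y%:P) * q)`_m.+1 = x * q`_m.
  split; last first.
    rewrite mulrBl coefB coefCM -scalerAl coefZ coefXM /=.
    by rewrite [q`_m.+1]nth_default // mulr0 subr0.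
  apply: leq_trans (size_polyMleq _ _) _; rewrite -subn1 leq_subLR.
  rewrite (leq_add _ sz : _ <= 2 + m.+1)%N //.
  rewrite (leq_trans (size_polyD _ _)) // geq_max size_polyN.
  rewrite (leq_trans (size_scale_leq _ _)) ?size_polyX //.
  by rewrite (leq_trans (size_polyC_leq1 _)).
rewrite !big_cons; case: ifP => _.
- have [sz' co] := step z^* r; rewrite [q * _]mulrCA -(ler_pM2l r0) wnorm_reflect // [_ * (q * _)]mulrA.
  apply: le_trans (IH _ _ sz'); rewrite co.
  rewrite normrM norm_conjC exprMn (exprS r) le_eqVlt; apply/orP; left; apply/eqP.
  by move: (bigop _ _ _) => Z; ring.
- have [sz' co] := step 1 z; rewrite -{1}['X]scale1r [q * _]mulrCA [_ * (q * _)]mulrA.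
  apply: le_trans (IH _ _ sz'); rewrite co.
  rewrite mul1r (exprS r) le_eqVlt; apply/orP; left; apply/eqP.
  by move: (bigop _ _ _) => Z; ring.
Qed.
End RadialNorm.

(** * Hadamard's inequality *)

Lemma sum_sqr_row (C : numClosedFieldType) n (M : 'M[C]_n) i :
  \sum_j `|M i j| ^+ 2 = (M *m M^t*) i i.
Proof. by rewrite mxE; apply: eq_bigr => j _; rewrite !mxE normCK. Qed.

(** Gram-Schmidt gives [A = T U] with [U] unitary and [T] lower triangular. Then [|det A|] is the
    product of the [|T i i|], each at most the norm of row [i] of [T], which equals that of row [i]
    of [A]. *)
Lemma Hadamard (C : numClosedFieldType) n (A : 'M[C]_n) :
  `|\det A| ^+ 2 <= \prod_i \sum_j `|A i j| ^+ 2.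
Proof.
pose U := schmidt A; pose T := A *m U^t*.
have Uu : U \is unitarymx by exact: schmidt_unitarymx.
have AE : A = T *m U by rewrite /T mulmxKtV.
have detU : `|\det U| ^+ 2 = 1.
  have /unitarymxP/(congr1 determinant) := Uu.
  by rewrite det_mulmx det1 det_map_mx det_tr normCK.
have rowA i : \sum_j `|A i j| ^+ 2 = \sum_j `|T i j| ^+ 2.
  rewrite !sum_sqr_row AE trmx_mul map_mxM mulmxA -(mulmxA T).
  by rewrite (unitarymxP Uu) mulmx1.
have trigT : is_trig_mx T.
  apply/is_trig_mxP => i j lt_ij.
  (* [T i j] is the inner product of row [i] of [A] with row [j] of [U]; it vanishes for [i < j]
     because row [i] of [A] lies in the span of the orthonormal rows [k <= i] of [U]. *)
  have -> : T i j = (row i A *m (row j U)^t*) 0 0.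
    by rewrite !mxE; apply: eq_bigr => k _; rewrite !mxE.
  have [u ->] := submxP (row_schmidt_sub A i).
  rewrite -mulmxA; suff -> : (\sum_(k < n | (k <= i)%N) <<row k U>>)%MS *m (row j U)^t* = 0.
    by rewrite mulmx0 mxE.
  apply/sub_kermxP.
  apply/sumsmx_subP => k le_ki; rewrite genmxE; apply/sub_kermxP/matrixP => x y.
  rewrite !ord1; have /row_unitarymxP/(_ k j) := Uu; rewrite dotmxE => ->.
  by rewrite mxE -val_eqE /= ltn_eqF // (leq_ltn_trans le_ki).
rewrite [in \det _]AE det_mulmx normrM exprMn detU mulr1 det_trig //.
rewrite normr_prod -prodrXl; apply: ler_prod => i _; rewrite exprn_ge0 //=.
by rewrite rowA (bigD1 i) //= lerDl sumr_ge0 // => j _; rewrite exprn_ge0.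
Qed.

(** * The homogeneous Vandermonde determinant *)

Definition hvander_det (R : comNzRingType) n (u v : 'I_n.+1 -> R) : R :=
  \det (\matrix_(i < n.+1, j < n.+1) (u j ^+ i * v j ^+ (n - i))).
Definition cross (R : comNzRingType) n (u v : 'I_n.+1 -> R) : R :=
  \prod_(i < n.+1) \prod_(j < n.+1 | (i < j)%N) (u j * v i - u i * v j).

(** Taking [v j ^+ n] out of column [j] leaves the Vandermonde matrix of the ratios [u j / v j].
    Each index lies in exactly [n] pairs, so these powers redistribute as one factor [v i * v j] per
    pair. *)
Lemma hvander_det_field (F : fieldType) n (u v : 'I_n.+1 -> F) :
  (forall i, v i != 0) -> hvander_det u v = cross u v.
Proof.
move=> v0; pose a : 'rV_n.+1 := \row_j (u j / v j).
have -> : hvander_det u v = \det (Vandermonde n.+1 a *m diag_mx (\row_j v j ^+ n)).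
  congr (\det _); apply/matrixP => i j; rewrite mul_mx_diag !mxE.
  have -> : v j ^+ n = v j ^+ i * v j ^+ (n - i).
    by rewrite -exprD subnKC // -ltnS.
  by rewrite mulrA -exprMn divfK.
rewrite det_mulmx det_Vandermonde det_diag.
have -> : \prod_i (\row_j v j ^+ n) 0 i
      = \prod_(i < n.+1) \prod_(j < n.+1 | (i < j)%N) (v i * v j).
  under [RHS]eq_bigr do rewrite big_split /=.
  rewrite big_split /= [X in _ * X](exchange_big_dep xpredT) //= -big_split /=.
  apply: eq_bigr => i _; rewrite mxE.
  have -> : v i ^+ n = \prod_(j | j != i) v i by rewrite prodr_const cardC1 card_ord.
  rewrite (bigID (fun j : 'I_n.+1 => (i < j)%N)) /=; congr (_ * _); apply: eq_bigl => j.
    by rewrite -val_eqE /=; case: ltngtP.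
  by rewrite -val_eqE /=; case: ltngtP.
rewrite -big_split; apply: eq_bigr => i _; rewrite -big_split; apply: eq_bigr => j _.
by rewrite !mxE /=; field; rewrite !v0.
Qed.

(* Translating every [v i] by an indeterminate makes them all nonzero. *)
Lemma det_homogeneous_Vandermonde (F : fieldType) n (u v : 'I_n.+1 -> F) :
  \det (\matrix_(i < n.+1, j < n.+1) (u j ^+ i * v j ^+ (n - i))) =
  \prod_(i < n.+1) \prod_(j < n.+1 | (i < j)%N) (u j * v i - u i * v j).
Proof.
pose U i := (u i)%:P : {poly F}; pose V i := (v i)%:P + 'X : {poly F}.
have rmorph_hdet (R S : comNzRingType) (g : {rmorphism R -> S}) (x y : 'I_n.+1 -> R) :
    g (hvander_det x y) = hvander_det (g \o x) (g \o y).
  rewrite /hvander_det -det_map_mx; congr (\det _); apply/matrixP => i j.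
  by rewrite !mxE rmorphM !rmorphXn.
have rmorph_cross (R S : comNzRingType) (g : {rmorphism R -> S}) (x y : 'I_n.+1 -> R) :
    g (cross x y) = cross (g \o x) (g \o y).
  rewrite /cross rmorph_prod; apply: eq_bigr => i _; rewrite rmorph_prod.
  by apply: eq_bigr => j _; rewrite rmorphB !rmorphM.
(* The identity holds in the fraction field of [{poly F}], each [V i] being monic; injectivity of
   the embedding brings it to [{poly F}], and evaluation at 0 to [u] and [v]. *)
have hvander_detUV : hvander_det U V = cross U V.
  apply/eqP; rewrite -tofrac_eq rmorph_hdet rmorph_cross; apply/eqP/hvander_det_field => i /=.
  by rewrite tofrac_eq0 /V addrC monic_neq0 // monicXaddC.
have := congr1 (horner_eval (0 : F)) hvander_detUV; rewrite rmorph_hdet rmorph_cross.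
rewrite /hvander_det /cross /= => H; rewrite -[LHS]/(hvander_det u v) -[RHS]/(cross u v).
have Eu i : (U i).[0] = u i by rewrite hornerC.
have Ev i : (V i).[0] = v i by rewrite hornerD hornerC hornerX addr0.
transitivity (hvander_det (horner_eval 0 \o U) (horner_eval 0 \o V)).
  by congr (\det _); apply/matrixP => i j; rewrite !mxE /= /horner_eval Eu Ev.
rewrite [LHS]H; apply: eq_bigr => i _; apply: eq_bigr => j _.
by rewrite /horner_eval !Eu !Ev.
Qed.

(** Hadamard's inequality with entries weighted by square roots of binomial coefficients: the
    squared norm of row [i] is then the binomial expansion of [(|u i|^2 + |v i|^2)^n]. *)
Lemma prod_cross_le (C : numClosedFieldType) n (u v : 'I_n.+1 -> C) :
  (\prod_(i < n.+1) 'C(n, i))%:R *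
    \prod_(i < n.+1) \prod_(j < n.+1 | (i < j)%N) `|u j * v i - u i * v j| ^+ 2
  <= \prod_i (`|u i| ^+ 2 + `|v i| ^+ 2) ^+ n.
Proof.
pose D : 'rV[C]_n.+1 := \row_(i < n.+1) sqrtC 'C(n, i)%:R.
pose B : 'M_n.+1 := \matrix_(i < n.+1, j < n.+1) (u j ^+ i * v j ^+ (n - i)).
have := Hadamard (B^T *m diag_mx D).
rewrite det_mulmx det_tr det_diag normrM exprMn det_homogeneous_Vandermonde mulrC.
congr (_ <= _).
  rewrite !normr_prod -!prodrXl natr_prod; congr (_ * _).
    apply: eq_bigr => i _; rewrite mxE ger0_norm ?sqrtC_ge0 ?ler0n //.
    by rewrite sqrtCK.
  by apply: eq_bigr => i _; rewrite normr_prod -prodrXl.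
apply: eq_bigr => i _; rewrite addrC exprDn; apply: eq_bigr => j _.
rewrite mul_mx_diag !mxE !normrM !normrX [`|sqrtC _|]ger0_norm ?sqrtC_ge0 ?ler0n //.
by rewrite -[RHS]mulr_natr -[X in _ = _ * X]sqrtCK -!exprM ![(2 * _)%N]mulnC !exprM; ring.
Qed.

(** * Translation between pairs of reals and [R[i]] *)

Local Open Scope complex_scope.
Delimit Scope R_scope with coqR.

Definition toC (z : Cx) : R[i] := Cre z +i* Cim z.

Lemma toC_inj : injective toC.
Proof. by move=> [a b] [c d] [-> ->]. Qed.

Lemma toCB z w : toC (Csub z w) = toC z - toC w.
Proof. by []. Qed.

Lemma toCM z w : toC (Cmul z w) = toC z * toC w.
Proof. by []. Qed.

Lemma toCX z n : toC (Cpow z n) = toC z ^+ n.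
Proof. by elim: n => [|n IH] //=; rewrite exprS -IH. Qed.

Lemma toC_scal_nat n z : toC (Cscal (INR n) z) = toC z *+ n.
Proof.
case: z => a b; rewrite /toC /Cscal /= INRE RmultE.
elim: n => [|n IH]; first by rewrite mulr0n !RmultE !mul0r.
by rewrite [RHS]mulrS -IH -natr1 !RmultE !mulrDl !mul1r addrC.
Qed.

Lemma toC_sum n f : toC (Cfsum n f) = \sum_(i < n) toC (f i).
Proof. by elim: n => [|n IH]; rewrite ?big_ord0 // big_ord_recr /= -IH. Qed.

Lemma normC_toC z : `|toC z| ^+ 2 = (Cnorm2 z)%:C.
Proof. by rewrite -add_Re2_Im2 /= /Cnorm2 !RpowE RplusE. Qed.

Lemma fsumE n f : fsum n f = \sum_(i < n) f i.
Proof. by elim: n => [|n IH]; rewrite ?big_ord0 // big_ord_recr /= -IH. Qed.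

Lemma exp_fsum n f : exp (fsum n f) = \prod_(i < n) exp (f i).
Proof.
elim: n => [|n IH] /=; first by rewrite big_ord0 exp_0.
by rewrite big_ord_recr /= -IH exp_plus.
Qed.

Lemma nth_nthE (T : Type) (d : T) s i : List.nth i s d = nth d s i.
Proof. by elim: s i => [|x s IH] [|i] //=. Qed.

(** * Monic polynomials with a full list of distinct roots *)

Section Polynomial.
Variables (N : nat) (a : nat -> Cx) (zs : list Cx).
Hypotheses (a_monic : is_monic_deg N a) (size_zs : length zs = N).
Hypotheses (uniq_zs : NoDup zs) (root_zs : forall z, In z zs -> is_root N a z).

Let P : {poly R[i]} := \poly_(i < N.+1) toC (a i).

Lemma poly_roots_prod : P = \prod_(z <- zs) ('X - (toC z)%:P).
Proof.
have aN : toC (a N) = 1 by rewrite a_monic.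
have lP : lead_coef P = 1 by rewrite lead_coef_poly //= aN ?oner_eq0.
rewrite (@all_roots_prod_XsubC _ P (map toC zs)) ?lP ?scale1r ?big_map //.
- by rewrite size_map size_poly_eq /= ?aN ?oner_eq0 // -size_zs.
- rewrite all_map; elim: (zs) root_zs => //= z s IH rt; apply/andP; split.
    apply/eqP; rewrite -[0]/(toC Defs.C0) -(rt z (or_introl erefl)).
    rewrite horner_poly toC_sum.
    by apply: eq_bigr => i _; rewrite toCM toCX.
  by apply: IH => w ws; apply: rt; right.
- rewrite uniq_rootsE; elim: uniq_zs => //= z s nz _ ->; rewrite andbT.
  apply/negP => /mapP[w ws /toC_inj zw]; apply: nz; rewrite zw.
  elim: s ws => //= y s IH; rewrite inE => /orP[/eqP ->|/IH]; first by left.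
  by right.
Qed.

(** Landau's inequality for squared radius [r = t / (1 - t)], multiplied by [(1 - t) ^ N]: [r ^ k]
    becomes [t ^ k * (1 - t) ^ (N - k)], and [max(r, Z)] becomes [max(t, Z * (1 - t))]. *)
Lemma Landau_lower_bound t : (0 < t)%coqR -> (t < 1)%coqR ->
  (exp (fsum N (fun j => ln (Rmax t (Cnorm2 (List.nth j zs Defs.C0) * (1 - t)))))
   <= fsum N.+1 (fun k => Cnorm2 (a k) * t ^ k * (1 - t) ^ (N - k)))%coqR.
Proof.
move=> /RltP t0 /RltP t1; have {t1}u0 : 0 < 1 - t by rewrite subr_gt0.
pose r := t / (1 - t); have r0 : 0 < r by rewrite divr_gt0.
have rE : r * (1 - t) = t by rewrite divfK ?gt_eqF.
clearbody r.
(* Reflecting exactly the roots outside the circle makes each factor the larger of [r] and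
   [|z|^2]. *)
pose big (z : R[i]) := t < (complex.Re z ^+ 2 + complex.Im z ^+ 2) * (1 - t).
have r0C : 0 < r%:C by rewrite ltcR.
have := @wnorm_prod_XsubC _ r%:C big (map toC zs) 1 0 r0C; rewrite size_poly1.
move=> /(_ isT); rewrite coef1 normr1 expr1n expr0 !mul1r !big_map -poly_roots_prod.
rewrite (@wnorm_widen _ _ _ N.+1) ?size_poly //.
under eq_bigr do rewrite normC_toC.
have -> : \prod_(z <- zs) (if big (toC z) then (Cnorm2 z)%:C else r%:C)
    = (\prod_(z <- zs) (if big (toC z) then Cnorm2 z else r))%:C.
  by rewrite rmorph_prod; apply: eq_bigr => z _; case: ifP.
have -> : \sum_(i < N.+1) `|P`_i| ^+ 2 * r%:C ^+ i
    = (\sum_(i < N.+1) Cnorm2 (a i) * r ^+ i)%:C.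
  rewrite rmorph_sum; apply: eq_bigr => i _.
  by rewrite coef_poly ltn_ord normC_toC [RHS]rmorphM rmorphXn.
rewrite lecR -(ler_pM2r (exprn_gt0 N u0)) => le_prod; apply/RleP.
rewrite exp_fsum fsumE; move: le_prod; congr (_ <= _).
  rewrite (big_nth Defs.C0) big_mkord -[size zs]/(length zs) size_zs.
  rewrite -[N in _ ^+ N]card_ord -prodr_const -big_split.
  apply: eq_bigr => i _ /=; rewrite nth_nthE exp_ln; last first.
    by apply: Rlt_le_trans (Rmax_l _ _); apply/RltP.
  rewrite RmaxE !RealsE maxEle; set z := nth _ _ _.
  rewrite /big /= -!RpowE -RplusE -/(Cnorm2 z).
  rewrite (fun_if (fun x => x * (1 - t))) rE.
  by rewrite leNgt; case: ltP => // lt; case: ltgtP lt.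
rewrite mulr_suml; apply: eq_bigr => i _; rewrite !RealsE.
have le_iN : (i <= N)%N by rewrite -ltnS.
have -> : (1 - t) ^+ N = (1 - t) ^+ i * (1 - t) ^+ (N - i) by rewrite -exprD subnKC.
have -> : t ^+ i = r ^+ i * (1 - t) ^+ i by rewrite -exprMn rE.
by rewrite !mulrA.
Qed.

(** In the product rule only the term differentiating the factor that vanishes at root [i]
    survives. *)
Lemma deriv_at_root i : (i < N)%N ->
  Cnorm2 (pderiv_eval N a (List.nth i zs Defs.C0)) =
  \prod_(j < N | j != i :> nat)
     Cnorm2 (Csub (List.nth i zs Defs.C0) (List.nth j zs Defs.C0)).
Proof.
move=> lt_iN; set z := List.nth i _ _.
have PE : toC (pderiv_eval N a z) = P^`().[toC z].
  rewrite toC_sum big_ord_recl toC_scal_nat mulr0n add0r.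
  rewrite (@horner_coef_wide _ N); last first.
    apply: leq_trans (size_poly _ _) _; rewrite -subn1 leq_subLR add1n.
    exact: size_poly.
  apply: eq_bigr => j _.
  by rewrite toC_scal_nat toCM toCX coef_deriv coef_poly ltnS ltn_ord mulrnAl.
apply: (@complexI R) => /=; rewrite -normC_toC rmorph_prod /=.
under [RHS]eq_bigr do rewrite -normC_toC.
rewrite PE poly_roots_prod (big_nth Defs.C0) big_mkord -[size zs]/(length zs) size_zs.
rewrite (bigD1 (Ordinal lt_iN)) //= derivM hornerD !hornerM -nth_nthE -/z.
rewrite derivXsubC hornerXsubC subrr mul0r addr0 hornerE mul1r.
rewrite horner_prod normr_prod -prodrXl; apply: eq_bigr => j _.
by rewrite hornerXsubC -nth_nthE toCB.
Qed.

Lemma ln_deriv_at_root i : (i < N)%coq_nat ->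
  (forall j, (j < N)%coq_nat -> i <> j ->
     0 < Cnorm2 (Csub (List.nth i zs Defs.C0) (List.nth j zs Defs.C0)))%coqR ->
  ln (Cnorm2 (pderiv_eval N a (List.nth i zs Defs.C0))) =
  fsum N (fun j => match Nat.eq_dec i j with
     | left _ => 0%coqR
     | right _ => ln (Cnorm2 (Csub (List.nth i zs Defs.C0) (List.nth j zs Defs.C0)))
     end).
Proof.
move=> lt_iN sep; rewrite deriv_at_root; last exact/ssrnat.ltP.
rewrite -[RHS]ln_exp exp_fsum big_mkcond; congr (ln _); apply: eq_bigr => j _.
case: Nat.eq_dec => /= [ij|ne_ij]; first by rewrite -ij eqxx exp_0.
rewrite exp_ln; last by apply: sep => //; apply/ssrnat.ltP.
by case: eqP => // ji; case: ne_ij.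
Qed.
End Polynomial.

(** * The cross-product inequality in logarithmic form *)

Lemma binomialE n k : (k <= n)%N -> Binomial.C n k = 'C(n, k)%:R.
Proof.
move=> le_kn; rewrite /Binomial.C !INRE !factE RdivE RmultE -natrM -(bin_fact le_kn).
by rewrite natrM mulfK // pnatr_eq0 -lt0n muln_gt0 !fact_gt0.
Qed.

(** Logarithm of [prod_cross_le] for unit pairs, whose right-hand side is 1. *)
Lemma cross_product_bound n (u v : nat -> Cx) :
  (forall i, (i <= n)%coq_nat -> Rplus (Cnorm2 (u i)) (Cnorm2 (v i)) = 1%coqR) ->
  (forall i j, (i <= n)%coq_nat -> (j < i)%coq_nat ->
    (0 < Cnorm2 (Csub (Cmul (u i) (v j)) (Cmul (u j) (v i))))%coqR) ->
  (fsum n.+1 (fun k => ln (Binomial.C n k))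
   + fsum n.+1 (fun i => fsum i (fun j =>
       ln (Cnorm2 (Csub (Cmul (u i) (v j)) (Cmul (u j) (v i)))))) <= 0)%coqR.
Proof.
move=> uv1 cross_gt0; apply: Rnot_lt_le => /exp_increasing.
apply: Rle_not_lt; apply/RleP; rewrite exp_plus exp_0 !exp_fsum.
have le_ord (i : 'I_n.+1) : (i <= n)%N by rewrite -ltnS.
have := prod_cross_le (fun i : 'I_n.+1 => toC (u i)) (fun i => toC (v i)).
rewrite [X in _ <= X]big1 => [|i _]; last first.
  by rewrite !normC_toC -rmorphD /= -RplusE uv1 ?rmorph1 ?expr1n //; apply/ssrnat.leP.
rewrite -lecR rmorph1 !rmorphM; congr (_ * _ <= _).
  rewrite natr_prod rmorph_prod; apply: eq_bigr => i _.
  by rewrite exp_ln ?binomialE ?rmorph_nat //; apply/RltP; rewrite ltr0n bin_gt0.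
(* [prod_cross_le] groups the pairs by their smaller index, the nested [fsum] by the larger one. *)
rewrite rmorph_prod (exchange_big_dep xpredT) //=; apply: eq_bigr => i _.
rewrite exp_fsum rmorph_prod (big_ord_widen_cond n.+1 xpredT
  (fun j => (exp (ln (Cnorm2 (Csub (Cmul (u i) (v j)) (Cmul (u j) (v i))))))%:C)).
  apply: eq_bigr => j lt_ji; rewrite -!toCM -toCB normC_toC exp_ln //.
  by apply: cross_gt0; apply/ssrnat.leP; move: lt_ji; rewrite ?le_ord ?andbT.
by rewrite ltnW.
Qed.

End Algebraic.

(* Coquelicot states equalities at the carrier of a normed module, which [ring] rejects. *)
Ltac eqR := match goal with |- @eq _ ?x ?y => change (@eq R x y) end.

(** * Euler's Beta integrals [B(k+1, m+1)] *)

Definition beta k m := INR (fact k) * INR (fact m) / INR (fact (k + m + 1)).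

Lemma is_RInt_beta k m :
  is_RInt (fun t => t ^ k * (1 - t) ^ m) 0 1 (beta k m).
Proof.
  revert k; induction m as [|m IH]; intros k.
  - apply is_RInt_ext with (fun t => t ^ k); [intros; eqR; ring|].
    replace (beta k 0) with (1 ^ (k + 1) / INR (k + 1) - 0 ^ (k + 1) / INR (k + 1)).
    + apply (is_RInt_derive (fun t => t ^ (k + 1) / INR (k + 1))).
      * intros t _; auto_derive; [trivial|].
        replace (Init.Nat.pred (k + 1)) with k by lia. field.
        apply not_0_INR; lia.
      * intros t _; apply (ex_derive_continuous (fun t => t ^ k)); auto_derive; trivial.
    + unfold beta. rewrite pow1, pow_i by lia.
      replace (k + 0 + 1)%nat with (S k) by lia. replace (k + 1)%nat with (S k) by lia.
      change (fact (S k)) with (S k * fact k)%nat. rewrite mult_INR. simpl (fact 0).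
      change (INR 1) with 1. field. split; [apply INR_fact_neq_0|apply not_0_INR; lia].
  (* Integration by parts: [F] vanishes at both endpoints, which trades a power of [1 - t] for one
     of [t]. *)
  - set (F := fun t => t ^ (k + 1) * (1 - t) ^ (S m) / INR (k + 1)).
    assert (Hk : INR (k + 1) <> 0) by (apply not_0_INR; lia).
    apply is_RInt_ext with
      (fun t => (t ^ k * (1 - t) ^ S m - INR (S m) / INR (k + 1) * (t ^ (S k) * (1 - t) ^ m))
        + INR (S m) / INR (k + 1) * (t ^ (S k) * (1 - t) ^ m)); [intros; eqR; ring|].
    replace (beta k (S m)) with ((F 1 - F 0) + INR (S m) / INR (k + 1) * beta (S k) m).
    + apply (is_RInt_plus (V := R_NormedModule)).
      * apply (is_RInt_derive F).
        -- intros t _; unfold F; auto_derive; [trivial|].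
           replace (Init.Nat.pred (k + 1)) with k by lia.
           change (Init.Nat.pred (S m)) with m. replace (k + 1)%nat with (S k) in * by lia.
           change (match m with 0%nat => 1 | S _ => INR m + 1 end) with (INR (S m)).
           change (1 + - t) with (1 - t). rewrite <- !tech_pow_Rmult. field. exact Hk.
        -- intros t _; apply (ex_derive_continuous
             (fun t => t ^ k * (1 - t) ^ S m - INR (S m) / INR (k + 1) * (t ^ (S k) * (1 - t) ^ m))).
           auto_derive; trivial.
      * apply (is_RInt_scal (V := R_NormedModule)). apply IH.
    + unfold F, beta. rewrite (pow_i (k + 1)) by lia.
      replace (1 - 1) with 0 by ring. rewrite (pow_i (S m)) by lia.
      replace (S k + m + 1)%nat with (k + S m + 1)%nat by lia.
      change (fact (S k)) with (S k * fact k)%nat.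
      change (fact (S m)) with (S m * fact m)%nat. rewrite !mult_INR.
      replace (S k) with (k + 1)%nat by lia. field.
      split; [apply INR_fact_neq_0|exact Hk].
Qed.

(** Up to the factor [N + 1], the Beta integrals are the Bombieri-Weyl weights. *)
Lemma beta_binomial N k : (k <= N)%nat ->
  beta k (N - k) = / (INR (S N) * Binomial.C N k).
Proof.
  intros Hk. unfold beta, Binomial.C.
  replace (k + (N - k) + 1)%nat with (S N) by lia.
  change (fact (S N)) with (S N * fact N)%nat. rewrite mult_INR.
  field. repeat split; try apply INR_fact_neq_0. apply not_0_INR; lia.
Qed.

(** * Finite sums and their integrals *)

Lemma fsum_ext n f g : (forall i, (i < n)%nat -> f i = g i) -> fsum n f = fsum n g.
Proof.
  induction n as [|n IH]; intros H; [reflexivity|].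
  simpl. rewrite IH by (intros; apply H; lia). rewrite H by lia. reflexivity.
Qed.

Lemma fsum_le n f g : (forall i, (i < n)%nat -> f i <= g i) -> fsum n f <= fsum n g.
Proof.
  induction n as [|n IH]; intros H; simpl; [lra|].
  apply Rplus_le_compat; [apply IH; intros|]; apply H; lia.
Qed.

Lemma fsum_plus n f g : fsum n (fun i => f i + g i) = fsum n f + fsum n g.
Proof. induction n as [|n IH]; simpl; [ring|rewrite IH; ring]. Qed.

Lemma fsum_scal n c f : fsum n (fun i => c * f i) = c * fsum n f.
Proof. induction n as [|n IH]; simpl; [ring|rewrite IH; ring]. Qed.

Lemma fsum_const n c : fsum n (fun _ => c) = INR n * c.
Proof. induction n as [|n IH]; [simpl; ring|rewrite S_INR; simpl; rewrite IH; ring]. Qed.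

Lemma is_RInt_fsum n (f : nat -> R -> R) a b v :
  (forall k, (k < n)%nat -> is_RInt (f k) a b (v k)) ->
  is_RInt (fun t => fsum n (fun k => f k t)) a b (fsum n v).
Proof.
  induction n as [|n IH]; intros H; simpl.
  - rewrite <- (Rmult_0_r (b - a)) at 1. apply (is_RInt_const (V := R_NormedModule)).
  - apply (is_RInt_plus (V := R_NormedModule)); [apply IH; intros|]; apply H; lia.
Qed.

(** * Logarithmic integrals and the lower bound on the Bombieri-Weyl norm *)

Lemma xlnx_ge x : 0 < x -> x - 1 <= x * ln x.
Proof.
  intros Hx. assert (H : ln (/ x) <= / x - 1).
  { apply Rnot_lt_le; intros H. apply exp_increasing in H.
    rewrite exp_ln in H by (apply Rinv_0_lt_compat; lra).
    pose proof (exp_ineq1_le (/ x - 1)). lra. }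
  rewrite ln_Rinv in H by exact Hx.
  apply Rmult_le_compat_l with (r := x) in H; [|lra].
  rewrite Rmult_minus_distr_l, Rinv_r in H by lra. lra.
Qed.

Lemma is_RInt_ln_weighted s a b : 0 < a <= b -> 0 < s ->
  is_RInt (fun t => ln (t * s)) a b
    (b * ln b - b - (a * ln a - a) + (b - a) * ln s).
Proof.
  intros Hab Hs.
  apply is_RInt_ext with (fun t => ln t + ln s).
  { rewrite Rmin_left, Rmax_right by lra. intros t Ht. eqR. rewrite ln_mult; lra. }
  replace (b * ln b - b - (a * ln a - a) + (b - a) * ln s) with
   ((b * ln b - b + b * ln s) - (a * ln a - a + a * ln s)) by ring.
  apply (is_RInt_derive (fun t => t * ln t - t + t * ln s)).
  - rewrite Rmin_left, Rmax_right by lra. intros t Ht. auto_derive; [lra|]. field; lra.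
  - rewrite Rmin_left, Rmax_right by lra. intros t Ht.
    apply (ex_derive_continuous (fun t => ln t + ln s)). auto_derive. lra.
Qed.

Lemma is_RInt_ln_weighted_refl s a b : a <= b < 1 -> 0 < s ->
  is_RInt (fun t => ln (s * (1 - t))) a b
    ((1 - a) * ln (1 - a) + a - ((1 - b) * ln (1 - b) + b) + (b - a) * ln s).
Proof.
  intros Hab Hs.
  apply is_RInt_ext with (fun t => ln s + ln (1 - t)).
  { rewrite Rmin_left, Rmax_right by lra. intros t Ht. eqR. rewrite ln_mult; lra. }
  replace ((1 - a) * ln (1 - a) + a - ((1 - b) * ln (1 - b) + b) + (b - a) * ln s) with
   ((- ((1 - b) * ln (1 - b)) - b + b * ln s) - (- ((1 - a) * ln (1 - a)) - a + a * ln s)) by ring.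
  apply (is_RInt_derive (fun t => - ((1 - t) * ln (1 - t)) - t + t * ln s)).
  - rewrite Rmin_left, Rmax_right by lra. intros t Ht. auto_derive; [lra|].
    change (1 + - t) with (1 - t). field; lra.
  - rewrite Rmin_left, Rmax_right by lra. intros t Ht.
    apply (ex_derive_continuous (fun t => ln s + ln (1 - t))). auto_derive. lra.
Qed.

(* With [s = Z / (1 + Z)], the integrand is [ln (1 + Z) + ln (max (t (1 - s)) (s (1 - t)))],
   and the second term has integral exactly [-1] over [[0, 1]], whatever [s]. *)
Lemma is_RInt_ln_max Z d : 0 <= Z -> 0 < d < 1 ->
  exists v, is_RInt (fun t => ln (Rmax t (Z * (1 - t)) / (1 + Z))) d 1 v /\ -1 <= v.
Proof.
  intros HZ Hd. set (s := Z / (1 + Z)).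
  assert (Hs : 1 - s = / (1 + Z)) by (unfold s; field; lra).
  assert (H1s : 0 < 1 - s) by (rewrite Hs; apply Rinv_0_lt_compat; lra).
  assert (Hs0 : 0 <= s) by (unfold s; apply Rdiv_le_0_compat; lra).
  assert (HZs : forall t, Z * (1 - t) = s * (1 - t) * (1 + Z)) by (intro; unfold s; field; lra).
  assert (Hl : forall t, s <= t -> Rmax t (Z * (1 - t)) / (1 + Z) = t * (1 - s)).
  { intros t Ht. eqR. rewrite Rmax_left; [rewrite Hs; reflexivity|].
    rewrite HZs. apply Rmult_le_reg_r with (1 - s); [exact H1s|].
    rewrite Hs at 1. rewrite Rmult_assoc, Rinv_r by lra. nra. }
  assert (Hr : forall t, t <= s -> Rmax t (Z * (1 - t)) / (1 + Z) = s * (1 - t)).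
  { intros t Ht. eqR. rewrite Rmax_right; [rewrite HZs; field; lra|].
    rewrite HZs. apply Rmult_le_reg_r with (1 - s); [exact H1s|].
    rewrite Hs at 2. rewrite (Rmult_assoc _ (1 + Z)), Rinv_r by lra. nra. }
  pose proof (xlnx_ge (1 - d) ltac:(lra)) as Hx.
  (* The maximum changes branch at [t = s]; if [s <= d], only [t * (1 - s)] occurs on the
     interval. *)
  destruct (Rle_lt_dec s d) as [Hsd|Hsd].
  - eexists; split.
    + apply is_RInt_ext with (fun t => ln (t * (1 - s))).
      { rewrite Rmin_left, Rmax_right by lra. intros t Ht. eqR. rewrite Hl by lra. reflexivity. }
      apply is_RInt_ln_weighted; lra.
    + rewrite ln_1.
      assert (ln d <= 0) by (rewrite <- ln_1; apply ln_le; lra).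
      assert (ln (1 - d) <= ln (1 - s)) by (apply ln_le; lra). nra.
  - eexists; split.
    + apply (is_RInt_Chasles (V := R_NormedModule)) with s.
      * apply is_RInt_ext with (fun t => ln (s * (1 - t))).
        { rewrite Rmin_left, Rmax_right by lra. intros t Ht. eqR. rewrite Hr by lra. reflexivity. }
        apply is_RInt_ln_weighted_refl; lra.
      * apply is_RInt_ext with (fun t => ln (t * (1 - s))).
        { rewrite Rmin_left, Rmax_right by lra. intros t Ht. eqR. rewrite Hl by lra. reflexivity. }
        apply is_RInt_ln_weighted; lra.
    (* The terms in [(1 - s) * ln (1 - s)] and [s * ln s] cancel, leaving
       [-1 + d + (1 - d) * ln (1 - d) - d * ln s], which [Hx] bounds. *)
    + unfold plus; simpl. rewrite ln_1.
      assert (ln s <= 0) by (rewrite <- ln_1; apply ln_le; lra). nra.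
Qed.
(* [x >= 1 + ln x], applied to [exp N * prod_j h_j t], replaces Jensen's inequality; the
   integral starts at [d > 0] because [ln (h_j t)] is singular at [0] when [Z j = 0]. *)
Lemma Bombieri_norm_lower_bound N (c Z : nat -> R) :
  (forall k, 0 <= c k) -> (forall j, 0 <= Z j) ->
  (forall t, 0 < t -> t < 1 ->
     exp (fsum N (fun j => ln (Rmax t (Z j * (1 - t)))))
     <= fsum (S N) (fun k => c k * t ^ k * (1 - t) ^ (N - k))) ->
  INR (S N) / 2 * exp (fsum N (fun j => ln (1 + Z j)) - INR N)
    <= fsum (S N) (fun k => c k / Binomial.C N k).
Proof.
  intros Hc HZ Hle.
  set (A := exp (fsum N (fun j => ln (1 + Z j)) - INR N)).
  assert (HA : 0 < A) by apply exp_pos.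
  assert (HN : 0 < INR (S N)) by apply lt_0_INR, Nat.lt_0_succ.
  assert (HN1 : INR (S N) = INR N + 1) by apply S_INR.
  pose proof (pos_INR N) as HN0.
  (* This cut gives [(1 - d) * (1 + INR N) = INR N + 1 / 2]; the logarithms cost at most [N], and
     the remaining 1/2 is the one in the conclusion. *)
  set (d := / (2 * INR (S N))).
  assert (Hd : 0 < d < 1).
  { unfold d; split; [apply Rinv_0_lt_compat; lra|].
    rewrite <- Rinv_1. apply Rinv_lt_contravar; lra. }
  set (S0 := fun t => fsum (S N) (fun k => c k * t ^ k * (1 - t) ^ (N - k))).
  set (h := fun j t => Rmax t (Z j * (1 - t)) / (1 + Z j)).
  assert (HS0 : is_RInt S0 0 1 (fsum (S N) (fun k => c k * beta k (N - k)))).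
  { apply is_RInt_fsum. intros k _.
    apply is_RInt_ext with (fun t => c k * (t ^ k * (1 - t) ^ (N - k))).
    - intros; eqR; ring.
    - apply (is_RInt_scal (V := R_NormedModule)), is_RInt_beta. }
  assert (Hex : ex_RInt S0 0 1) by (eexists; exact HS0).
  assert (Hex0 : ex_RInt S0 0 d) by (apply (ex_RInt_Chasles_1 (V := R_CompleteNormedModule)) with 1; [lra|exact Hex]).
  assert (Hex1 : ex_RInt S0 d 1) by (apply (ex_RInt_Chasles_2 (V := R_CompleteNormedModule)) with 0; [lra|exact Hex]).
  assert (Hpos : 0 <= RInt S0 0 d).
  { apply RInt_ge_0; [lra|exact Hex0|]. intros t Ht. unfold S0.
    eapply Rle_trans; [apply Rlt_le, exp_pos|apply Hle; lra]. }
  assert (Htot : RInt S0 0 d + RInt S0 d 1 = fsum (S N) (fun k => c k * beta k (N - k))).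
  { rewrite <- (is_RInt_unique _ _ _ _ HS0).
    exact (RInt_Chasles S0 0 d 1 Hex0 Hex1). }
  set (v := fun j => RInt (fun t => ln (h j t)) d 1).
  assert (Hv : forall j, is_RInt (fun t => ln (h j t)) d 1 (v j) /\ -1 <= v j).
  { intros j. destruct (is_RInt_ln_max (Z j) d (HZ j) Hd) as [w [Hw Hw1]].
    unfold v, h. rewrite (is_RInt_unique _ _ _ _ Hw). split; assumption. }
  set (L := fun t => A * ((1 + INR N) + fsum N (fun j => ln (h j t)))).
  assert (HL : is_RInt L d 1 (A * ((1 - d) * (1 + INR N) + fsum N v))).
  { apply (is_RInt_scal (V := R_NormedModule)), (is_RInt_plus (V := R_NormedModule)).
    - apply (is_RInt_const (V := R_NormedModule)).
    - apply is_RInt_fsum. intros; apply Hv. }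
  assert (HLS : A * ((1 - d) * (1 + INR N) + fsum N v) <= RInt S0 d 1).
  { apply (is_RInt_le L S0 d 1); [lra|exact HL|apply (RInt_correct (V := R_CompleteNormedModule)); exact Hex1|].
    intros t Ht. eapply Rle_trans; [|apply Hle; lra].
    replace (fsum N (fun j => ln (Rmax t (Z j * (1 - t)))))
      with ((fsum N (fun j => ln (1 + Z j)) - INR N)
            + (INR N + fsum N (fun j => ln (h j t)))).
    - rewrite exp_plus. unfold L. apply Rmult_le_compat_l; [apply Rlt_le, exp_pos|].
      rewrite Rplus_assoc. apply exp_ineq1_le.
    - ring_simplify. rewrite <- fsum_plus. apply fsum_ext. intros j _.
      pose proof (HZ j). unfold h. rewrite ln_div; [ring| |lra].
      eapply Rlt_le_trans; [|apply Rmax_l]. lra. }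
  assert (Hv1 : - INR N <= fsum N v).
  { replace (- INR N) with (fsum N (fun _ => -1)) by (rewrite fsum_const; ring).
    apply fsum_le. intros; apply Hv. }
  assert (Hd1 : (1 - d) * (1 + INR N) = INR N + 1 / 2).
  { unfold d. rewrite HN1. field. lra. }
  assert (Hb : fsum (S N) (fun k => c k * beta k (N - k))
    = / INR (S N) * fsum (S N) (fun k => c k / Binomial.C N k)).
  { rewrite <- fsum_scal. apply fsum_ext. intros k Hk.
    rewrite beta_binomial by lia. rewrite Rinv_mult. unfold Rdiv. ring. }
  assert (HA2 : A * (1 / 2) <= / INR (S N) * fsum (S N) (fun k => c k / Binomial.C N k)).
  { rewrite <- Hb, <- Htot. apply Rle_trans with (RInt S0 d 1); [|lra].
    eapply Rle_trans; [|exact HLS]. apply Rmult_le_compat_l; lra. }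
  apply Rmult_le_compat_l with (r := INR (S N)) in HA2; [|lra].
  rewrite <- (Rmult_assoc _ (/ INR (S N))), Rinv_r, Rmult_1_l in HA2 by lra. lra.
Qed.

(** * Stirling's bound and the product of a row of binomial coefficients *)

(** The difference of the sides has derivative [y ^ 2 / ((1 + y) * (2 + y) ^ 2)]. At [x = / m] the
    bound reads [ln ((m + 1) / m) >= / (m + 1 / 2)], as Stirling requires. *)
Lemma ln_1_plus_ge x : 0 <= x -> 2 * x / (2 + x) <= ln (1 + x).
Proof.
  intros Hx. set (f := fun t => ln (1 + t) - 2 * t / (2 + t)).
  assert (H : f 0 <= f x).
  { destruct (MVT_gen f 0 x (fun t => / (1 + t) - 4 / (2 + t) ^ 2)) as [y [Hy E]].
    - rewrite Rmin_left, Rmax_right by lra. intros t Ht. unfold f.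
      auto_derive; [lra|]. field; lra.
    - rewrite Rmin_left, Rmax_right by lra. intros t Ht.
      apply continuity_pt_filterlim, (ex_derive_continuous f).
      unfold f. auto_derive. lra.
    - rewrite Rmin_left, Rmax_right in Hy by lra.
      assert (0 <= / (1 + y) - 4 / (2 + y) ^ 2).
      { replace (/ (1 + y) - 4 / (2 + y) ^ 2) with (y ^ 2 / ((1 + y) * (2 + y) ^ 2))
          by (field; lra).
        apply Rdiv_le_0_compat; nra. }
      nra. }
  unfold f in H. rewrite Rplus_0_r, ln_1 in H. lra.
Qed.

(** Stirling's upper bound with constant [e]; the induction step is
    [(m + 1 / 2) * ln ((m + 1) / m) >= 1]. *)
Lemma ln_fact_le n :
  ln (INR (fact (S n))) <= 1 + (INR (S n) + 1 / 2) * ln (INR (S n)) - INR (S n).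
Proof.
  induction n as [|n IH].
  - simpl. rewrite ln_1. lra.
  - set (m := S n) in *. change (fact (S m)) with (S m * fact m)%nat.
    assert (Hm : 0 < INR m) by (apply lt_0_INR; unfold m; lia).
    rewrite mult_INR, S_INR.
    rewrite ln_mult; [|lra|apply INR_fact_lt_0].
    pose proof (ln_1_plus_ge (/ INR m) (Rlt_le _ _ (Rinv_0_lt_compat _ Hm))) as H.
    replace (1 + / INR m) with ((INR m + 1) / INR m) in H by (field; lra).
    rewrite ln_div in H by lra.
    replace (2 * / INR m / (2 + / INR m)) with (/ (INR m + 1 / 2)) in H by (field; lra).
    apply Rmult_le_compat_l with (r := INR m + 1 / 2) in H; [|lra].
    rewrite Rinv_r in H by lra. lra.
Qed.

Lemma fsum_shift n f : fsum (S n) f = f 0%nat + fsum n (fun i => f (S i)).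
Proof.
  induction n as [|n IH]; [simpl; ring|].
  change (fsum (S (S n)) f) with (fsum (S n) f + f (S n)). rewrite IH. simpl. ring.
Qed.

Lemma fsum_ln_fact n : fsum n (fun k => ln (INR (n - k))) = ln (INR (fact n)).
Proof.
  induction n as [|n IH]; [simpl; rewrite ln_1; reflexivity|].
  rewrite fsum_shift. rewrite Nat.sub_0_r. simpl (S n - S _)%nat. rewrite IH.
  change (fact (S n)) with (S n * fact n)%nat. rewrite mult_INR, ln_mult; [reflexivity| |].
  - apply lt_0_INR; lia.
  - apply INR_fact_lt_0.
Qed.

Lemma binomial_pos n k : 0 < Binomial.C n k.
Proof.
  apply Rdiv_lt_0_compat; [|apply Rmult_lt_0_compat]; apply INR_fact_lt_0.
Qed.

(** From row [n] to row [n + 1] of Pascal's triangle, the product of the entries gains the factor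
    [(n + 1) ^ (n + 1) / (n + 1)!], whose logarithm is at least [n - ln (n + 1) / 2] by Stirling. *)
Lemma sum_ln_binomial_ge n :
  INR n * (INR n - 1) / 2 - INR n / 2 * ln (INR (S n))
    <= fsum (S n) (fun k => ln (Binomial.C n k)).
Proof.
  induction n as [|n IH].
  - simpl. unfold Binomial.C. simpl. replace (1 / (1 * 1)) with 1 by field.
    rewrite ln_1. lra.
  - assert (E : fsum (S (S n)) (fun k => ln (Binomial.C (S n) k))
      = fsum (S n) (fun k => ln (Binomial.C n k))
        + (INR (S n) * ln (INR (S n)) - ln (INR (fact (S n))))).
    { rewrite <- (fsum_ln_fact (S n)), <- fsum_const.
      change (fsum (S (S n)) (fun k => ln (Binomial.C (S n) k)))
        with (fsum (S n) (fun k => ln (Binomial.C (S n) k)) + ln (Binomial.C (S n) (S n))).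
      assert (C1 : Binomial.C (S n) (S n) = 1).
      { unfold Binomial.C. rewrite Nat.sub_diag. simpl (fact 0). change (INR 1) with 1.
        field. apply INR_fact_neq_0. }
      rewrite C1, ln_1, Rplus_0_r.
      apply (Rplus_eq_reg_r (fsum (S n) (fun k => ln (INR (S n - k))))).
      rewrite <- fsum_plus. ring_simplify. rewrite <- fsum_plus.
      apply fsum_ext. intros k Hk.
      assert (0 < INR (S n - k)) by (apply lt_0_INR; lia).
      assert (0 < INR (S n)) by (apply lt_0_INR; lia).
      rewrite <- !ln_mult by (try apply binomial_pos; assumption). f_equal.
      unfold Binomial.C. replace (S n - k)%nat with (S (n - k)) by lia.
      change (fact (S n)) with (S n * fact n)%nat.
      change (fact (S (n - k))) with (S (n - k) * fact (n - k))%nat.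
      rewrite !mult_INR. field. repeat split; try apply INR_fact_neq_0.
      apply not_0_INR; lia. }
    rewrite E. pose proof (ln_fact_le n) as HF.
    assert (Hln : ln (INR (S n)) <= ln (INR (S (S n)))).
    { apply ln_le; [apply lt_0_INR; lia|apply le_INR; lia]. }
    rewrite (S_INR n) in *. pose proof (pos_INR n). nra.
Qed.

(** * Off-diagonal sums, chordal distance, spinors and stereographic coordinates *)

Lemma sqr_le_0 x : x ^ 2 <= 0 -> x = 0.
Proof. intros H. apply Rsqr_0_uniq. pose proof (Rle_0_sqr x). unfold Rsqr in *. lra. Qed.

Lemma fsum_except n i f : (i < n)%nat ->
  fsum n (fun j => if Nat.eq_dec i j then 0 else f j) = fsum n f - f i.
Proof.
  induction n as [|n IH]; intros Hi; [lia|]. simpl.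
  destruct (Nat.eq_dec i n) as [->|Hne].
  - replace (fsum n (fun j => if Nat.eq_dec n j then 0 else f j)) with (fsum n f); [ring|].
    apply fsum_ext. intros j Hj. destruct (Nat.eq_dec n j); [lia|reflexivity].
  - rewrite IH by lia. ring.
Qed.

Lemma fsum_off_diagonal n f : (forall i j, f i j = f j i) ->
  fsum n (fun i => fsum n (fun j => if Nat.eq_dec i j then 0 else f i j))
  = 2 * fsum n (fun i => fsum i (f i)).
Proof.
  intros Hf. induction n as [|n IH]; [simpl; ring|].
  assert (Hlast : fsum n (fun j => if Nat.eq_dec n j then 0 else f n j) = fsum n (f n)).
  { apply fsum_ext. intros j Hj. destruct (Nat.eq_dec n j); [lia|reflexivity]. }
  change (fsum n (fun i => fsum n (fun j => if Nat.eq_dec i j then 0 else f i j)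
        + (if Nat.eq_dec i n then 0 else f i n))
    + (fsum n (fun j => if Nat.eq_dec n j then 0 else f n j)
        + (if Nat.eq_dec n n then 0 else f n n))
    = 2 * (fsum n (fun i => fsum i (f i)) + fsum n (f n))).
  rewrite fsum_plus, IH, Hlast. destruct (Nat.eq_dec n n) as [_|H]; [|lia].
  replace (fsum n (fun i => if Nat.eq_dec i n then 0 else f i n)) with (fsum n (f n)); [ring|].
  apply fsum_ext. intros i Hi. destruct (Nat.eq_dec i n); [lia|apply Hf].
Qed.

Definition dist3_sqr (x y : P3) : R :=
  (px x - px y) ^ 2 + (py x - py y) ^ 2 + (pz x - pz y) ^ 2.

Lemma dist3_sqr_pos x y : x <> y -> 0 < dist3_sqr x y.
Proof.
  destruct x as [[a b] c], y as [[a' b'] c']. unfold dist3_sqr, px, py, pz; simpl.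
  intros Hne. apply Rnot_le_lt. intros H. apply Hne.
  pose proof (pow2_ge_0 (a - a')). pose proof (pow2_ge_0 (b - b')).
  pose proof (pow2_ge_0 (c - c')).
  assert (a - a' = 0) by (apply sqr_le_0; lra).
  assert (b - b' = 0) by (apply sqr_le_0; lra).
  assert (c - c' = 0) by (apply sqr_le_0; lra).
  repeat f_equal; lra.
Qed.

Lemma ln_sqrt x : 0 < x -> ln (sqrt x) = / 2 * ln x.
Proof.
  intros Hx. rewrite <- (sqrt_sqrt x) at 2 by lra.
  rewrite ln_mult by (apply sqrt_lt_R0; exact Hx). field.
Qed.

Lemma ln_dist3 x y : x <> y -> ln (dist3 x y) = / 2 * ln (dist3_sqr x y).
Proof. intros H. apply ln_sqrt, dist3_sqr_pos, H. Qed.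

Lemma dist3_sym x y : dist3 x y = dist3 y x.
Proof. unfold dist3. f_equal. ring. Qed.

Lemma on_sphere_pz_lt x : on_sphere x -> x <> north_pole -> pz x < 1.
Proof.
  destruct x as [[a b] c]. unfold on_sphere, north_pole, px, py, pz; simpl.
  intros Hs Hn. apply Rnot_le_lt. intros Hc. apply Hn.
  assert (c = 1) by nra. subst c.
  assert (a = 0) by (apply sqr_le_0; nra). assert (b = 0) by (apply sqr_le_0; nra). subst; reflexivity.
Qed.

(* Unit spinor [(u, v)] representing a point of the sphere: [u / v] is its stereographic
   projection, the north pole being [(1, 0)]. *)
Definition spinor_v (x : P3) : Cx := (sqrt ((1 - pz x) / 2), 0).
Definition spinor_u (x : P3) : Cx :=
  if Req_dec_T (pz x) 1 then Defs.C1
  else (px x / (2 * sqrt ((1 - pz x) / 2)), py x / (2 * sqrt ((1 - pz x) / 2))).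

(** With [s = |v|] as parameter, identities away from the north pole become rational in [s]. *)
Lemma spinor_cases x : on_sphere x ->
  (x = north_pole /\ spinor_u x = Defs.C1 /\ spinor_v x = Defs.C0) \/
  (exists s, 0 < s /\ pz x = 1 - 2 * s ^ 2 /\ spinor_v x = (s, 0) /\
     spinor_u x = (px x / (2 * s), py x / (2 * s))).
Proof.
  intros Hs. unfold spinor_u, spinor_v. destruct (Req_dec_T (pz x) 1) as [E|E].
  - left. rewrite E. replace ((1 - 1) / 2) with 0 by field. rewrite sqrt_0.
    split; [|split; reflexivity]. destruct x as [[a b] c].
    unfold on_sphere, north_pole, px, py, pz in *; simpl in *. subst c.
    assert (a = 0) by (apply sqr_le_0; nra). assert (b = 0) by (apply sqr_le_0; nra). subst; reflexivity.
  - right. assert (Hz : pz x < 1).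
    { apply on_sphere_pz_lt; [exact Hs|]. intros ->. apply E; reflexivity. }
    exists (sqrt ((1 - pz x) / 2)). split; [apply sqrt_lt_R0; lra|].
    split; [|split; reflexivity].
    rewrite <- Rsqr_pow2, Rsqr_sqrt by lra. field.
Qed.

Lemma spinor_unit x : on_sphere x -> Cnorm2 (spinor_u x) + Cnorm2 (spinor_v x) = 1.
Proof.
  intros Hs. destruct (spinor_cases x Hs) as [[_ [-> ->]]|[s [Hs0 [Hz [-> ->]]]]];
    unfold Cnorm2, Cre, Cim; simpl fst; simpl snd.
  - unfold Defs.C1, Defs.C0; simpl. ring.
  - unfold on_sphere in Hs. rewrite Hz in Hs.
    replace (_ + _) with ((px x ^ 2 + py x ^ 2) / (4 * s ^ 2) + s ^ 2) by (field; lra).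
    replace (px x ^ 2 + py x ^ 2) with (1 - (1 - 2 * s ^ 2) ^ 2) by lra. field; lra.
Qed.

(** Unlike the stereographic formula, this one covers the north pole, which an arbitrary
    configuration may contain. *)
Lemma dist3_sqr_spinor x y : on_sphere x -> on_sphere y ->
  dist3_sqr x y =
  4 * Cnorm2 (Csub (Cmul (spinor_u x) (spinor_v y)) (Cmul (spinor_u y) (spinor_v x))).
Proof.
  intros Hx Hy. unfold dist3_sqr.
  destruct (spinor_cases x Hx) as [[-> [-> ->]]|[s [Hs0 [Hz [-> ->]]]]];
  destruct (spinor_cases y Hy) as [[-> [-> ->]]|[r [Hr0 [Hw [-> ->]]]]];
    unfold Cnorm2, Csub, Cmul, Cre, Cim, Defs.C1, Defs.C0, north_pole, on_sphere, px, py, pz in *;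
    simpl fst in *; simpl snd in *.
  - ring.
  - rewrite Hw in *. nra.
  - rewrite Hz in *. nra.
  - set (a := fst (fst x)) in *. set (b := snd (fst x)) in *.
    set (c := fst (fst y)) in *. set (d := snd (fst y)) in *.
    rewrite Hz, Hw in *.
    (* Only the horizontal squared norms, known from the sphere equations, and the product
       [a * c + b * d], common to both sides, remain. *)
    replace (4 * _) with ((a ^ 2 + b ^ 2) * (r ^ 2 / s ^ 2) + (c ^ 2 + d ^ 2) * (s ^ 2 / r ^ 2)
      - 2 * (a * c + b * d)) by (field; lra).
    replace (a ^ 2 + b ^ 2) with (1 - (1 - 2 * s ^ 2) ^ 2) by lra.
    replace (c ^ 2 + d ^ 2) with (1 - (1 - 2 * r ^ 2) ^ 2) by lra.
    replace ((a - c) ^ 2 + (b - d) ^ 2) with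
      ((a ^ 2 + b ^ 2) + (c ^ 2 + d ^ 2) - 2 * (a * c + b * d)) by ring.
    replace (a ^ 2 + b ^ 2) with (1 - (1 - 2 * s ^ 2) ^ 2) by lra.
    replace (c ^ 2 + d ^ 2) with (1 - (1 - 2 * r ^ 2) ^ 2) by lra. field; lra.
Qed.

(** Since [1 + |stereo x|^2 = 2 / (1 - pz x)], both sides reduce to the same multiple of
    [1 - <x, y>]. *)
Lemma dist3_sqr_stereo x y : on_sphere x -> on_sphere y -> pz x < 1 -> pz y < 1 ->
  dist3_sqr x y * ((1 + Cnorm2 (stereo x)) * (1 + Cnorm2 (stereo y)))
  = 4 * Cnorm2 (Csub (stereo x) (stereo y)).
Proof.
  destruct x as [[a b] c], y as [[a' b'] c'].
  unfold dist3_sqr, on_sphere, Cnorm2, Csub, stereo, Cre, Cim, px, py, pz; simpl fst; simpl snd.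
  intros Hx Hy Hc Hc'.
  replace (1 + ((a / (1 - c)) ^ 2 + (b / (1 - c)) ^ 2)) with (2 / (1 - c)).
  2: { replace ((a / (1 - c)) ^ 2 + (b / (1 - c)) ^ 2)
         with ((a ^ 2 + b ^ 2) / (1 - c) ^ 2) by (field; lra).
       replace (a ^ 2 + b ^ 2) with (1 - c ^ 2) by lra. field; lra. }
  replace (1 + ((a' / (1 - c')) ^ 2 + (b' / (1 - c')) ^ 2)) with (2 / (1 - c')).
  2: { replace ((a' / (1 - c')) ^ 2 + (b' / (1 - c')) ^ 2)
         with ((a' ^ 2 + b' ^ 2) / (1 - c') ^ 2) by (field; lra).
       replace (a' ^ 2 + b' ^ 2) with (1 - c' ^ 2) by lra. field; lra. }
  replace (_ + _) with ((a ^ 2 + b ^ 2 + c ^ 2) + (a' ^ 2 + b' ^ 2 + c' ^ 2)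
     - 2 * (a * a' + b * b' + c * c')) by ring.
  rewrite Hx, Hy.
  replace ((a / (1 - c) - a' / (1 - c')) ^ 2 + (b / (1 - c) - b' / (1 - c')) ^ 2)
    with ((a ^ 2 + b ^ 2) / (1 - c) ^ 2 + (a' ^ 2 + b' ^ 2) / (1 - c') ^ 2
       - 2 * (a * a' + b * b') / ((1 - c) * (1 - c'))) by (field; lra).
  replace (a ^ 2 + b ^ 2) with (1 - c ^ 2) by lra.
  replace (a' ^ 2 + b' ^ 2) with (1 - c' ^ 2) by lra. field; lra.
Qed.

Lemma Cnorm2_nonneg z : 0 <= Cnorm2 z.
Proof. unfold Cnorm2. nra. Qed.

(** The positivity claim also serves as injectivity of [stereo]. *)
Lemma ln_dist3_stereo x y : on_sphere x -> on_sphere y -> pz x < 1 -> pz y < 1 -> x <> y ->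
  0 < Cnorm2 (Csub (stereo x) (stereo y)) /\
  ln (dist3 x y) = ln 2 + / 2 * ln (Cnorm2 (Csub (stereo x) (stereo y)))
    - / 2 * ln (1 + Cnorm2 (stereo x)) - / 2 * ln (1 + Cnorm2 (stereo y)).
Proof.
  intros Hx Hy Hxz Hyz Hne.
  pose proof (dist3_sqr_stereo x y Hx Hy Hxz Hyz) as E.
  pose proof (dist3_sqr_pos x y Hne) as Hd.
  pose proof (Cnorm2_nonneg (stereo x)). pose proof (Cnorm2_nonneg (stereo y)).
  assert (Hp : 0 < (1 + Cnorm2 (stereo x)) * (1 + Cnorm2 (stereo y))) by nra.
  assert (Hc : 0 < Cnorm2 (Csub (stereo x) (stereo y))).
  { pose proof (Rmult_lt_0_compat _ _ Hd Hp). lra. }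
  split; [exact Hc|]. rewrite ln_dist3 by exact Hne.
  apply (f_equal ln) in E. replace 4 with (2 * 2) in E by ring.
  rewrite !ln_mult in E by lra. lra.
Qed.

(** * Lower and upper bounds on the energy *)

Lemma nth_neq (A : Type) (l : list A) d i j : NoDup l ->
  (i < length l)%nat -> (j < length l)%nat -> i <> j -> nth i l d <> nth j l d.
Proof. intros Hl Hi Hj Hij E. apply Hij. eapply NoDup_nth; eassumption. Qed.

(** In the sum of [ln] of distances, each ordered pair contributes [ln 2] and each unordered pair
    the logarithm of a squared spinor cross product, controlled by [cross_product_bound]. *)
Lemma E_log_lower_bound n mu : sphere_config (S n) mu ->
  fsum (S n) (fun k => ln (Binomial.C n k)) - INR (S n) * INR n * ln 2 <= E_log mu.
Proof.
  intros [Hlen [Hnd Hsph]]. rewrite Forall_forall in Hsph.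
  set (x := fun i => nth i mu default_pt).
  assert (Hx : forall i, (i < S n)%nat -> on_sphere (x i)).
  { intros i Hi. apply Hsph, nth_In. lia. }
  assert (Hne : forall i j, (i < S n)%nat -> (j < i)%nat -> x i <> x j).
  { intros i j Hi Hj. apply nth_neq; try assumption; lia. }
  set (w := fun i j => Cnorm2 (Csub (Cmul (spinor_u (x i)) (spinor_v (x j)))
                                    (Cmul (spinor_u (x j)) (spinor_v (x i))))).
  assert (Hw : forall i j, (i < S n)%nat -> (j < i)%nat -> 0 < w i j).
  { intros i j Hi Hj. pose proof (dist3_sqr_pos _ _ (Hne i j Hi Hj)) as H.
    rewrite dist3_sqr_spinor in H by (apply Hx; lia). unfold w. lra. }
  assert (HC : fsum (S n) (fun k => ln (Binomial.C n k))
     + fsum (S n) (fun i => fsum i (fun j => ln (w i j))) <= 0).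
  { apply (cross_product_bound (n := n) (u := fun i => spinor_u (x i))
      (v := fun i => spinor_v (x i))).
    - intros i Hi. apply spinor_unit, Hx. lia.
    - intros i j Hi Hj. apply Hw; lia. }
  unfold E_log. rewrite Hlen.
  change (fsum (S n) (fun k => ln (Binomial.C n k)) - INR (S n) * INR n * ln 2
    <= - fsum (S n) (fun i => fsum (S n) (fun j =>
           if Nat.eq_dec i j then 0 else ln (dist3 (x i) (x j))))).
  rewrite (fsum_off_diagonal (S n) (fun i j => ln (dist3 (x i) (x j))))
    by (intros; rewrite dist3_sym; reflexivity).
  assert (E : 2 * fsum (S n) (fun i => fsum i (fun j => ln (dist3 (x i) (x j))))
    = fsum (S n) (fun i => INR i * (2 * ln 2))
      + fsum (S n) (fun i => fsum i (fun j => ln (w i j)))).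
  { rewrite <- fsum_scal, <- fsum_plus. apply fsum_ext. intros i Hi.
    rewrite <- fsum_const, <- fsum_scal, <- fsum_plus. apply fsum_ext. intros j Hj.
    rewrite ln_dist3 by (apply Hne; lia).
    rewrite dist3_sqr_spinor by (apply Hx; lia). fold (w i j).
    replace 4 with (2 * 2) by ring.
    assert (0 < w i j) by (apply Hw; lia). rewrite !ln_mult by lra. field. }
  assert (G : forall m, fsum (S m) (fun i => INR i * (2 * ln 2)) = INR (S m) * INR m * ln 2).
  { induction m as [|m IH]; [simpl; ring|].
    change (fsum (S m) (fun i => INR i * (2 * ln 2)) + INR (S m) * (2 * ln 2)
      = INR (S (S m)) * INR (S m) * ln 2). rewrite IH, !S_INR. ring. }
  rewrite G in E. lra.
Qed.

(** The condition number at each root bounds the corresponding row of the double sum below by one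
    constant; there are [S n] rows. *)
Lemma E_log_upper_bound K n a omega : 0 < K ->
  is_monic_deg (S n) a -> mu_norm_le (S n) a (K * sqrt (INR (S n))) ->
  sphere_config (S n) omega ->
  (forall x, In x omega -> x <> north_pole) ->
  (forall x, In x omega -> is_root (S n) a (stereo x)) ->
  E_log omega <= - (INR (S n) * (INR n * ln 2 - ln K
     + / 2 * (ln (INR (S n)) - ln 2 - INR (S n)))).
Proof.
  intros HK Hmonic Hmu [Hlen [Hnd Hsph]] Hnp Hroot. rewrite Forall_forall in Hsph.
  set (N := S n) in *.
  set (zs := map stereo omega).
  assert (Hz1 : forall x, In x omega -> pz x < 1).
  { intros x Hx. apply on_sphere_pz_lt; auto. }
  assert (Hlz : length zs = N) by (unfold zs; rewrite length_map; exact Hlen).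
  assert (Hnz : NoDup zs).
  { apply NoDup_map_NoDup_ForallPairs; [|exact Hnd]. intros x y Hx Hy E.
    apply Classical_Prop.NNPP. intros Hne.
    destruct (ln_dist3_stereo x y) as [H _]; auto.
    rewrite E in H. unfold Csub, Cnorm2, Cre, Cim in H. simpl in H. lra. }
  assert (Hrz : forall z, In z zs -> is_root N a z).
  { intros z Hz. apply in_map_iff in Hz. destruct Hz as [x [<- Hx]]. auto. }
  set (x := fun i => nth i omega default_pt).
  assert (Hin : forall i, (i < N)%nat -> In (x i) omega).
  { intros i Hi. apply nth_In. lia. }
  assert (Hnth : forall i, (i < N)%nat -> nth i zs Defs.C0 = stereo (x i)).
  { intros i Hi. unfold zs, x. rewrite (nth_indep _ Defs.C0 (stereo default_pt)).
    - apply map_nth.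
    - rewrite length_map. lia. }
  assert (Hne : forall i j, (i < N)%nat -> (j < N)%nat -> i <> j -> x i <> x j).
  { intros i j Hi Hj Hij. apply nth_neq; try assumption; lia. }
  set (l := fun i => ln (1 + Cnorm2 (nth i zs Defs.C0))).
  set (B2 := fsum (S N) (fun k => Cnorm2 (a k) / Binomial.C N k)).
  assert (HB : INR (S N) / 2 * exp (fsum N l - INR N) <= B2).
  { apply (Bombieri_norm_lower_bound N (fun k => Cnorm2 (a k))
      (fun j => Cnorm2 (nth j zs Defs.C0))); [intros; apply Cnorm2_nonneg ..|].
    exact (Landau_lower_bound Hmonic Hlz Hnz Hrz). }
  assert (HN : 0 < INR N) by (apply lt_0_INR; unfold N; lia).
  assert (HSN : 0 < INR (S N)) by (apply lt_0_INR; lia).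
  assert (HB0 : 0 < INR (S N) / 2 * exp (fsum N l - INR N)).
  { apply Rmult_lt_0_compat; [lra|apply exp_pos]. }
  assert (HlB : ln (INR N) - ln 2 + fsum N l - INR N <= ln B2).
  { apply Rle_trans with (2 := ln_le _ _ HB0 HB).
    rewrite ln_mult, ln_exp, ln_div by (try apply exp_pos; lra).
    assert (ln (INR N) <= ln (INR (S N))) by (apply ln_le; [lra|apply le_INR; lia]). lra. }
  assert (HBpos : 0 < B2) by lra.
  assert (Hrow : forall i, (i < N)%nat ->
     INR n * ln 2 - ln K + / 2 * (ln (INR N) - ln 2 - INR N)
     <= fsum N (fun j => if Nat.eq_dec i j then 0 else ln (dist3 (x i) (x j)))).
  { intros i Hi. set (z := nth i zs Defs.C0). set (D := Cnorm2 (pderiv_eval N a z)).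
    destruct (Hmu z) as [HD0 HDle].
    { apply Hrz, nth_In. lia. }
    assert (HD : 0 < D).
    { unfold D. destruct (pderiv_eval N a z) as [p q]. unfold Cnorm2, Cre, Cim; simpl.
      apply Rnot_le_lt. intros H. apply HD0. unfold Defs.C0. f_equal; apply sqr_le_0; nra. }
    assert (HlD : ln D
      = fsum N (fun j => if Nat.eq_dec i j then 0 else ln (Cnorm2 (Csub z (nth j zs Defs.C0))))).
    { apply (ln_deriv_at_root Hmonic Hlz Hnz Hrz Hi). intros j Hj Hij.
      rewrite !Hnth by assumption. apply ln_dist3_stereo; auto. }
    assert (Hsum : fsum N (fun j => if Nat.eq_dec i j then 0 else ln (dist3 (x i) (x j)))
      = / 2 * ln D + fsum N (fun j => if Nat.eq_dec i j then 0 else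
           (ln 2 - / 2 * l i) + - / 2 * l j)).
    { rewrite HlD, <- fsum_scal, <- fsum_plus. apply fsum_ext. intros j Hj.
      destruct (Nat.eq_dec i j) as [_|Hij]; [ring|].
      unfold z, l. rewrite !Hnth by assumption.
      destruct (ln_dist3_stereo (x i) (x j)) as [_ E]; auto. rewrite E. ring. }
    (* Removing the diagonal term leaves [l i] with coefficient [-(N / 2 - 1)] beside half of
       [fsum N l]: the former cancels the power of [1 + |z|^2] in the condition number, the latter
       is absorbed by [HlB]. *)
    rewrite Hsum, fsum_except by exact Hi. rewrite fsum_plus, fsum_const, fsum_scal.
    assert (HDs : 0 < Cabs (pderiv_eval N a z)) by (apply sqrt_lt_R0; exact HD).
    assert (HsN : 0 < sqrt (INR N)) by (apply sqrt_lt_R0; exact HN).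
    assert (HBs : 0 < BW_norm N a) by (apply sqrt_lt_R0; exact HBpos).
    assert (HR : 0 < Rpower (1 + Cnorm2 z) (INR N / 2 - 1)) by apply exp_pos.
    assert (Hmul : BW_norm N a * Rpower (1 + Cnorm2 z) (INR N / 2 - 1)
       <= K * Cabs (pderiv_eval N a z)).
    { apply Rmult_le_compat_r with (r := Cabs (pderiv_eval N a z)) in HDle; [|lra].
      unfold Rdiv in HDle. rewrite (Rmult_assoc _ (/ Cabs _)), Rinv_l in HDle by lra.
      apply Rmult_le_reg_l with (sqrt (INR N)); [exact HsN|]. nra. }
    apply ln_le in Hmul; [|apply Rmult_lt_0_compat; assumption].
    rewrite !ln_mult in Hmul by assumption.
    unfold BW_norm in Hmul. fold B2 in Hmul. rewrite ln_sqrt in Hmul by exact HBpos.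
    unfold Cabs in Hmul. fold D in Hmul. rewrite ln_sqrt in Hmul by exact HD.
    unfold Rpower in Hmul. rewrite ln_exp in Hmul. unfold z in Hmul. fold (l i) in Hmul.
    assert (EN : INR N = INR n + 1) by apply S_INR. rewrite EN in *. lra. }
  unfold E_log. rewrite Hlen. apply Ropp_le_contravar.
  rewrite <- fsum_const. apply fsum_le. exact Hrow.
Qed.

Theorem theorem1p1 :
  forall K : R, 0 < K ->
  exists c : R,
  forall p : nat -> nat -> Cx,
    (forall N : nat, (1 <= N)%nat ->
       is_monic_deg N (p N) /\ mu_norm_le N (p N) (K * sqrt (INR N))) ->
  forall (N : nat) (omega : list P3),
    (1 <= N)%nat ->
    sphere_config N omega ->
    (forall x, In x omega -> x <> north_pole) ->
    (forall z : Cx, is_root N (p N) z <-> exists x, In x omega /\ stereo x = z) ->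
    forall mu : list P3, sphere_config N mu ->
      E_log omega <= E_log mu + c * INR N.
Proof.
  (* Between the two bounds the [ln 2] terms of order [N ^ 2] cancel, the polynomial terms differ by
     [(3 * n + 1) / 2 <= 3 / 2 * N], and those in [ln N] leave [- ln N / 2 <= 0]. *)
  intros K HK. exists (ln K + / 2 * ln 2 + 3 / 2).
  intros p Hp N omega HN Homega Hnp Hroots mu Hmu.
  destruct (Hp N HN) as [Hmonic Hcond]. destruct N as [|n]; [lia|].
  assert (Hup := E_log_upper_bound K n (p (S n)) omega HK Hmonic Hcond Homega Hnp).
  assert (Hlow := E_log_lower_bound n mu Hmu).
  pose proof (sum_ln_binomial_ge n) as Hb.
  assert (Hup' := Hup (fun x Hx => proj2 (Hroots _) (ex_intro _ x (conj Hx eq_refl)))).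
  assert (Hln : 0 <= ln (INR (S n))).
  { rewrite <- ln_1. apply ln_le; [lra|]. change 1 with (INR 1). apply le_INR. lia. }
  rewrite S_INR in *. nra.
Qed.
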